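(* For integers $k\ge1$ and $n\ge4$ define \[ B_1(n,k)=\left\lceil\tfrac{4n}{3}\right\rceil(k+1)+\begin{cases}k+1,& n\equiv0\pmod3,\\0,&n\equiv1\pmod3,\\k,&n\equiv2\pmod3,\end{cases} \] \[ B_2(n,k)=6(n-2)\left\lceil\tfrac{k+4}{5}\right\rceil+12\left\lceil\tfrac{k+3-\lceil\frac{k+4}{5}\rceil}{3}\right\rceil, \] \[ B_3(n,k)=6(n-2)\left\lceil\tfrac{k+5}{5}\right\rceil+12\left\lceil\tfrac{k+3-\lceil\frac{k+5}{5}\rceil}{3}\right\rceil-2\left\lceil\tfrac n2\right\rceil. \] Then: (i) if $k\equiv 1\pmod 5$ and $k\ge 31$, then for all sufficiently large $n$, $B_2(n,k)$ is the smallest of $B_1(n,k),B_2(n,k),B_3(n,k)$; (ii) if $k\not\equiv1\pmod5$ and $k\ge 53$, then for all sufficiently large $n$, $B_3(n,k)$ is the smallest of $B_1(n,k),B_2(n,k),B_3(n,k)$.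
   Context: $B_1,B_2,B_3$ are upper bounds on the $[k]$-Roman domination number of the cylindrical grid $C_6\Box P_n$. In particular, under (i) or (ii), for all sufficiently large $n$ at least one of $B_2,B_3$ is smaller than $B_1$. *)

(* Defs.v *)
From mathcomp Require Import all_boot all_order all_algebra.

Set Implicit Arguments.
Unset Strict Implicit.
Unset Printing Implicit Defensive.

Import Order.TTheory GRing.Theory Num.Theory.

Local Open Scope ring_scope.

Definition ceil_div (a b : int) : int := Num.ceil (a%:~R / b%:~R : rat).

(* The bounds are int-valued so that every subtraction below is the genuine
   one, not the truncated subtraction of nat. *)

Definition B1 (n k : nat) : int :=
  ceil_div (4 * n%:Z) 3 * (k%:Z + 1) +
  (if n == 0 %[mod 3] then k%:Z + 1
   else if n == 1 %[mod 3] then 0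
   else k%:Z).

Definition B2 (n k : nat) : int :=
  6 * (n%:Z - 2) * ceil_div (k%:Z + 4) 5 +
  12 * ceil_div (k%:Z + 3 - ceil_div (k%:Z + 4) 5) 3.

Definition B3 (n k : nat) : int :=
  6 * (n%:Z - 2) * ceil_div (k%:Z + 5) 5 +
  12 * ceil_div (k%:Z + 3 - ceil_div (k%:Z + 5) 5) 3 -
  2 * ceil_div n%:Z 2.

(* Main.v *)
Require Import Defs.
From mathcomp Require Import all_boot all_order all_algebra.
From mathcomp Require Import zify.

(** For fixed [k], each bound is linear in [n] up to a bounded error, and the
    slopes decide. With [a] the ceiling of [(k+4)/5], the slope of [B1] is
    [4(k+1)/3] and that of [B2] is [6a]. If [k] is 1 mod 5, then the ceiling of
    [(k+5)/5] is [a+1], so [B3] has slope [6a+5]; writing [k = 5q+1], the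
    inequality [6(q+1) < 4(5q+2)/3] means [q > 5]. Otherwise the ceiling of
    [(k+5)/5] is [a], so [B3] is [B2] minus twice the ceiling of [n/2], and
    [6a-1 < 4(k+1)/3] holds for all such [k >= 53]. *)

Set Implicit Arguments.
Unset Strict Implicit.
Unset Printing Implicit Defensive.

Import Order.TTheory GRing.Theory Num.Theory.

Local Open Scope ring_scope.

(** Clearing the denominator of the ceiling inequalities leaves pure integer arithmetic for [lia]
    and [nia]. *)
Lemma ceil_div_bounds (a b : int) :
  0 < b -> a <= b * ceil_div a b /\ b * ceil_div a b < a + b.
Proof.
move=> b_gt0; have bQ_gt0 : 0 < b%:~R :> rat by rewrite ltr0z.
have := Num.Theory.ceil_itv (a%:~R / b%:~R : rat); rewrite -/(ceil_div a b).
case/andP; rewrite ltr_pdivlMr // ler_pdivrMr // -!intrM ltr_int ler_int.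
lia.
Qed.

Lemma B1_ge (n k : nat) : 4 * n%:Z * (k%:Z + 1) <= 3 * B1 n k.
Proof.
have [+ _] := ceil_div_bounds (4 * n%:Z) (isT : 0 < 3 :> int).
rewrite /B1; case: ifP => _; [|case: ifP => _]; nia.
Qed.

Lemma B2_lt_B1 (n k : nat) :
  (k = 1 %[mod 5])%N -> (31 <= k)%N -> (12 * (k + 6) <= n)%N ->
  B2 n k < B1 n k.
Proof.
move=> k1 k_ge n_ge; have := B1_ge n k; rewrite /B2.
have := ceil_div_bounds (k%:Z + 4) (isT : 0 < 5 :> int).
set a := ceil_div (k%:Z + 4) 5 => a_bd.
have := ceil_div_bounds (k%:Z + 3 - a) (isT : 0 < 3 :> int).
set c := ceil_div _ 3 => c_bd B1_ge.
(* The slack 1 yields a margin of [n] between the tripled bounds, and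
   [36 * c < 12 * (k + 6) <= n]. *)
have slope : 18 * a + 1 <= 4 * (k%:Z + 1) by lia.
nia.
Qed.

Lemma B2_lt_B3 (n k : nat) :
  (k = 1 %[mod 5])%N -> (6 <= n)%N -> B2 n k < B3 n k.
Proof.
move=> k1 n_ge; rewrite /B2 /B3.
have := ceil_div_bounds (k%:Z + 4) (isT : 0 < 5 :> int).
have := ceil_div_bounds (k%:Z + 5) (isT : 0 < 5 :> int).
set a := ceil_div (k%:Z + 4) 5; set a' := ceil_div (k%:Z + 5) 5 => a'_bd a_bd.
have -> : a' = a + 1 by lia.
have := ceil_div_bounds (k%:Z + 3 - a) (isT : 0 < 3 :> int).
have := ceil_div_bounds (k%:Z + 3 - (a + 1)) (isT : 0 < 3 :> int).
have := ceil_div_bounds n%:Z (isT : 0 < 2 :> int).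
(* The gain [6 * (n - 2)] must beat 12, as the other ceiling drops by at most 1, plus at most
   [n + 1]; hence [6 <= n]. *)
lia.
Qed.

Lemma B3_lt_B1 (n k : nat) :
  (k <> 1 %[mod 5])%N -> (53 <= k)%N -> (12 * (k + 6) <= n)%N ->
  B3 n k < B1 n k.
Proof.
move=> k1 k_ge n_ge; have := B1_ge n k; rewrite /B3.
have := ceil_div_bounds (k%:Z + 5) (isT : 0 < 5 :> int).
set a := ceil_div (k%:Z + 5) 5 => a_bd.
have := ceil_div_bounds (k%:Z + 3 - a) (isT : 0 < 3 :> int).
set c := ceil_div _ 3 => c_bd.
have := ceil_div_bounds n%:Z (isT : 0 < 2 :> int).
set h := ceil_div _ 2 => h_bd B1_ge.
(* Since [n <= 2 * h], tripling [B3] gives slope at most [18 * a - 3], so the margin is again [n].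
   The worst residue is 2 mod 5, last failing at [k = 52]. *)
have slope : 18 * a - 2 <= 4 * (k%:Z + 1) by lia.
nia.
Qed.

Lemma B3_lt_B2 (n k : nat) :
  (k <> 1 %[mod 5])%N -> (0 < n)%N -> B3 n k < B2 n k.
Proof.
move=> k1 n_gt0; rewrite /B2 /B3.
have := ceil_div_bounds (k%:Z + 4) (isT : 0 < 5 :> int).
have := ceil_div_bounds (k%:Z + 5) (isT : 0 < 5 :> int).
set a := ceil_div (k%:Z + 4) 5; set a' := ceil_div (k%:Z + 5) 5 => a'_bd a_bd.
have -> : a' = a by lia.
have := ceil_div_bounds n%:Z (isT : 0 < 2 :> int).
lia.
Qed.

Theorem theorem13 (k : nat) (k_ge1 : (1 <= k)%N) :
  ((k = 1 %[mod 5])%N -> (31 <= k)%N ->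
     exists N : nat, forall n : nat, (4 <= n)%N -> (N <= n)%N ->
       B2 n k < B1 n k /\ B2 n k < B3 n k) /\
  ((k <> 1 %[mod 5])%N -> (53 <= k)%N ->
     exists N : nat, forall n : nat, (4 <= n)%N -> (N <= n)%N ->
       B3 n k < B1 n k /\ B3 n k < B2 n k).
Proof.
split=> k1 k_ge; exists (12 * (k + 6))%N => n n_ge4 n_ge; split.
- exact: B2_lt_B1.
- by apply: B2_lt_B3; lia.
- exact: B3_lt_B1.
- by apply: B3_lt_B2; lia.
Qed.
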